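(* For integers $d$ and $k$ with $2\leq k\leq d+1$, there exists a constant $C=C(k)$ such that the following holds. Let $G=G(V,E)$ be a connected simple graph with vertex set $V=\{v_1,\ldots,v_k\}$ and edge set $E\subseteq\binom{V}{2}$. If $A_1,A_2,\ldots,A_k\subseteq\mathbb{F}_q^d$ satisfy $|A_i||A_j|\geq Cq^{d+k-1}$ for every $\{v_i,v_j\}\in E$, and $S\subseteq\prod_{i=1}^k A_i$ satisfies $|S|\sim\prod_{i=1}^k|A_i|$, then $$|\Pi_G(S)|\gtrsim q^{|E|},$$ i.e. $\Pi_G(S)$ contains a positive proportion of the elements of $(\mathbb{F}_q)^E$. In particular, $|\Pi_G(A_1\times A_2\times\cdots\times A_k)|\gtrsim q^{|E|}$.
   Context: $\mathbb{F}_q$ is the finite field with $q$ elements, and for $x,y\in\mathbb{F}_q^d$, $x\cdot y=\sum_{i=1}^d x_iy_i$. Notation: $X\lesssim Y$ means there is a constant $C'$ (independent of $q$ and of the sets involved) with $X\leq C'Y$; $X\gtrsim Y$ means $Y\lesssim X$; $X\sim Y$ means $X\lesssim Y$ and $Y\lesssim X$. For a graph $G=(V,E)$ with $V=\{v_1,\ldots,v_k\}$ and $S\subseteq(\mathbb{F}_q^d)^k$, $\Pi_G(S)$ is the set of functions $\alpha:E\to\mathbb{F}_q$ (viewed as vectors in $(\mathbb{F}_q)^E$) such that there exists $(x_1,\ldots,x_k)\in S$ with $x_i\cdot x_j=\alpha(\{v_i,v_j\})$ for every $\{v_i,v_j\}\in E$. *)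

(* Defs.v *)
(* Mathematical Components, with real constants in an arbitrary [realType]. *)
From HB Require Import structures.
From mathcomp Require Import all_boot all_order all_algebra.
From mathcomp Require Import reals.

Set Implicit Arguments.
Unset Strict Implicit.
Unset Printing Implicit Defensive.

Import Order.TTheory GRing.Theory Num.Theory.
Local Open Scope ring_scope.

(* X <~ Y and X ~ Y with the implied constant K made explicit: the quantifier
   over K, placed before the field and the sets, expresses uniformity. *)
Definition lesssim_upto (R : realType) (K : R) (X Y : nat) : Prop :=
  X%:R <= K * Y%:R.

Definition comparable_upto (R : realType) (K : R) (X Y : nat) : Prop :=
  lesssim_upto K X Y /\ lesssim_upto K Y X.

Definition dotp (F : finFieldType) (d : nat) (x y : 'rV[F]_d) : F :=
  \sum_(i < d) x 0 i * y 0 i.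

(* A graph on the vertex type V is given by its edge set, whose elements are
   unordered pairs of distinct vertices. *)
Definition simple_graph (V : finType) (E : {set {set V}}) : Prop :=
  forall e : {set V}, e \in E -> #|e| = 2%N.

Definition adj (V : finType) (E : {set {set V}}) : rel V :=
  [rel u v | [set u; v] \in E].

Definition connected_graph (V : finType) (E : {set {set V}}) : Prop :=
  forall u v : V, connect (adj E) u v.

Definition edge (V : finType) (E : {set {set V}}) := {e : {set V} | e \in E}.

Definition cart (F : finFieldType) (d k : nat) (A : 'I_k -> {set 'rV[F]_d}) :
    {set {ffun 'I_k -> 'rV[F]_d}} :=
  [set x in family A].

Definition Pi_G (F : finFieldType) (d k : nat) (E : {set {set 'I_k}})
    (S : {set {ffun 'I_k -> 'rV[F]_d}}) : {set {ffun edge E -> F}} :=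
  [set alpha : {ffun edge E -> F} |
    [exists x in S, forall e : edge E, forall i, forall j,
      (val e == [set i; j]) ==> (dotp (x i) (x j) == alpha e)]].

(* Main.v *)
(* The points are traded for dot products one vertex at a time, keeping track
   of the density of the resulting set of mixed configurations.  To eliminate a
   vertex v with t neighbours x_j among the vertices still in place, apply
   Cauchy-Schwarz: the density falls from delta to at least delta^2 / 2 provided
   that the number of (x, a, b) with a, b in A_v and (a - b).x_j = 0 for all j
   is at most twice its expected value q^-t |A_v|^2 prod_j |A_j|.

   Averaging [(a - b).(sum_j s_j x_j) = 0] - 1/q over s in F^t detects the
   condition on (a, b).  The term s = 0 is the expected value; if s_j <> 0, the
   combination z = sum_i s_i x_i is injective in x_j, so the sum over x_j in A_j
   is at most the sum over all z of the nonnegative quantity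
   #{(a, b) | (a - b).z = 0} - |A_v|^2 / q, which is less than q^d |A_v|.  Hence
   q^(d + t) <= |A_j| |A_v| suffices, and t <= k - 1; in particular C = 1 works. *)

Require Import Defs.
From HB Require Import structures.
From mathcomp Require Import all_boot all_order all_algebra.
From mathcomp Require Import reals.
From mathcomp Require Import zify ring lra.

Set Implicit Arguments.
Unset Strict Implicit.
Unset Printing Implicit Defensive.

Import Order.TTheory GRing.Theory Num.Theory.
Local Open Scope ring_scope.

(** * Cauchy-Schwarz and collisions of a map *)

Lemma sqr_sum_leq_card (I : finType) (D : {pred I}) (n : I -> nat) :
  ((\sum_(i in D) n i) ^ 2 <= #|D| * \sum_(i in D) n i ^ 2)%N.
Proof.
(* After doubling, both sides are double sums over [D], compared term by term through 2ab <= a^2 +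
   b^2. *)
rewrite -(leq_pmul2l (isT : 0 < 2)%N) expnS expn1 big_distrlr big_distrr /=.
have -> : (2 * (#|D| * \sum_(i in D) n i ^ 2)
    = \sum_(i in D) \sum_(j in D) (n i ^ 2 + n j ^ 2))%N.
  under [RHS]eq_bigr => i _ do rewrite big_split /= sum_nat_const.
  by rewrite big_split /= sum_nat_const -big_distrr /= addnn mul2n.
by apply: leq_sum => i _; rewrite big_distrr /=; apply: leq_sum => j _;
  exact: nat_Cauchy.
Qed.

(** Cauchy-Schwarz over the image: [#|D|] is the sum of the fibre sizes, and the number of colliding
    pairs is the sum of their squares. *)
Lemma card_sqr_leq_collisions (T T' : finType) (f : T -> T') (D : {set T}) :
  (#|D| ^ 2 <=
   #|f @: D| * #|[set p in setX D D | f p.1 == f p.2]|)%N.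
Proof.
have -> : #|[set p in setX D D | f p.1 == f p.2]|
    = (\sum_(t in f @: D) #|[set x in D | f x == t]| ^ 2)%N.
  rewrite -sum1_card
    (partition_big (fun p => f p.1) (fun t => t \in f @: D)) /=; last first.
    by case=> x y; rewrite !inE => /andP[/andP[xD _] _]; apply: imset_f.
  apply: eq_bigr => t _; rewrite sum1dep_card expnS expn1 -cardsX.
  apply: eq_card => -[x y]; rewrite !inE /=.
  case: (f x =P t) => [<-|_]; last by rewrite !andbF.
  by rewrite !andbT [f y == _]eq_sym andbA.
have {1}-> : #|D| = (\sum_(t in f @: D) #|[set x in D | f x == t]|)%N.
  rewrite -sum1_card (partition_big_imset f) /=.
  by apply: eq_bigr => t _; rewrite -sum1dep_card.
exact: sqr_sum_leq_card.
Qed.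

(** * Dot products, hyperplanes and orthogonality *)

Section DotProduct.

Variables (F : finFieldType) (d : nat).
Implicit Types x y z : 'rV[F]_d.

Lemma dotpC x y : dotp x y = dotp y x.
Proof. by apply: eq_bigr => i _; rewrite mulrC. Qed.

Lemma dotpDr x y z : dotp x (y + z) = dotp x y + dotp x z.
Proof.
by rewrite -big_split; apply: eq_bigr => i _; rewrite mxE mulrDr.
Qed.

Lemma dotpZr x c y : dotp x (c *: y) = c * dotp x y.
Proof.
by rewrite big_distrr; apply: eq_bigr => i _; rewrite mxE /= mulrCA.
Qed.

Lemma dotp0r x : dotp x 0 = 0.
Proof. by rewrite -(scale0r x) dotpZr mul0r. Qed.

Lemma dotpBl x y z : dotp (x - y) z = dotp x z - dotp y z.
Proof.
by rewrite dotpC -scaleN1r dotpDr dotpZr mulN1r dotpC [dotp z y]dotpC.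
Qed.

Lemma dotp_sumr (I : finType) (P : pred I) x (y : I -> 'rV[F]_d) :
  dotp x (\sum_(i | P i) y i) = \sum_(i | P i) dotp x (y i).
Proof. by apply: (big_morph _ (dotpDr x)); exact: dotp0r. Qed.

(** Choose [e] with x.e = 1: translation by c e carries the hyperplane onto the level set x.y = c,
    so the q level sets have equal size. *)
Lemma card_hyperplane x : x != 0 ->
  (#|F| * #|[set y | dotp x y == 0%R]| = #|F| ^ d)%N.
Proof.
move=> /rV0Pn[i xi0].
pose e : 'rV[F]_d := (x 0 i)^-1 *: delta_mx 0 i.
have xe : dotp x e = 1.
  rewrite dotpZr /dotp (bigD1 i) //= big1 ?addr0 => [|j ji].
    by rewrite mxE !eqxx mulr1 mulVf.
  by rewrite mxE (negPf ji) andbF mulr0.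
have card_fiber c : #|[set y | dotp x y == c]| = #|[set y | dotp x y == 0]|.
  rewrite -[RHS](card_imset _ (addIr (c *: e))); apply: eq_card => y.
  rewrite inE; apply/eqP/imsetP => [xy|[z]]; last first.
    by rewrite inE => /eqP xz ->; rewrite dotpDr xz dotpZr xe mulr1 add0r.
  exists (y - c *: e); last by rewrite subrK.
  by rewrite inE -scaleNr dotpDr xy dotpZr xe mulr1 subrr.
have -> : (#|F| ^ d)%N = #|{: 'rV[F]_d}| by rewrite card_mx mul1n.
rewrite -[RHS]sum1_card (partition_big (dotp x) predT) //=.
rewrite (eq_bigr (fun=> #|[set y | dotp x y == 0]|)) ?sum_nat_const // => c _.
by rewrite sum1dep_card -(card_fiber c); apply: eq_card => y; rewrite !inE.
Qed.

(** An integer form of the orthogonality of additive characters: q [x.y = 0] - 1 is the sum over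
    nonzero c in F of psi(c x.y), for a nontrivial character psi. *)
Lemma sum_orthogonality x :
  \sum_y (#|F|%:Z * (dotp x y == 0)%R%:Z - 1)
    = (#|F|%:Z - 1) * #|F|%:Z ^+ d * (x == 0)%R%:Z.
Proof.
have card_rV : #|{: 'rV[F]_d}| = (#|F| ^ d)%N by rewrite card_mx mul1n.
have sum1 : \sum_(y : 'rV[F]_d) (1 : int) = #|F|%:Z ^+ d.
  by rewrite sumr_const card_rV natrX natz.
rewrite sumrB sum1; have [->|x0] := eqVneq x 0.
  rewrite (eq_bigr (fun=> #|F|%:Z * 1)) => [|y _]; last by rewrite dotpC dotp0r eqxx.
  by rewrite -big_distrr /= sum1 mulr1 mulrBl mul1r.
rewrite mulr0 -big_distrr /=; apply/eqP; rewrite subr_eq0; apply/eqP.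
rewrite -[#|F|%:Z]natz -natrX -(card_hyperplane x0) natrM; congr (_ * _).
rewrite -sum1dep_card natr_sum [RHS]big_mkcond /=.
by apply: eq_bigr => y _; case: eqP.
Qed.

End DotProduct.

(** * Counting pairs with common dot products *)

Lemma card_family_prod (V T : finType) (B : V -> {set T}) :
  #|family B| = (\prod_v #|B v|)%N.
Proof. by rewrite card_family foldrE big_image. Qed.

Section CommonDotProducts.

Variables (F : finFieldType) (d : nat) (V : finType).
Implicit Types (A : {set 'rV[F]_d}) (B : V -> {set 'rV[F]_d}) (N : {set V}).
Implicit Types z : 'rV[F]_d.

Let q := #|F|.

Let q_gt1 : 1 < q%:Z :> int.
Proof. by rewrite ltz_nat card_finNzRing_gt1. Qed.

(** This is q times the difference between the number of pairs with (a - b).z = 0 and its expected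
    value |A|^2 / q; the scaling keeps it an integer. *)
Definition excess A z : int :=
  \sum_(p in setX A A) (q%:Z * (dotp (p.1 - p.2) z == 0)%R%:Z - 1).

(** Cauchy-Schwarz for x -> x.z on A, which takes at most q values. *)
Lemma excess_ge0 A z : 0 <= excess A z.
Proof.
have le_sqr : (#|A| ^ 2 <= q * #|[set p in setX A A | dotp (p.1 - p.2) z == 0%R]|)%N.
  apply: leq_trans (card_sqr_leq_collisions (fun x => dotp x z) A) _.
  rewrite leq_mul ?max_card //; apply: subset_leq_card.
  by apply/subsetP => -[x y]; rewrite !inE /= dotpBl subr_eq0.
rewrite /excess sumrB sumr_const cardsX natz mulnn subr_ge0 -big_distrr /=.
apply: le_trans (_ : Posz (q * _) <= _); first by rewrite lez_nat; exact: le_sqr.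
rewrite PoszM ler_pM2l ?ltz_nat ?(ltn_trans _ (card_finNzRing_gt1 F)) //.
rewrite -sum1dep_card -natz natr_sum big_mkcondr /=.
by apply: ler_sum => p _; case: ifP.
Qed.

Lemma excess0 A : excess A 0 = (q%:Z - 1) * (#|A| ^ 2)%N%:Z.
Proof.
rewrite /excess (eq_bigr (fun=> q%:Z - 1)); last first.
  by move=> p _; rewrite dotp0r eqxx mulr1.
by rewrite sumr_const cardsX mulnn -mulr_natr natz.
Qed.

(** By orthogonality only the diagonal pairs a = b survive the sum over z. *)
Lemma sum_excess A : \sum_z excess A z = (q%:Z - 1) * q%:Z ^+ d * #|A|%:Z.
Proof.
rewrite exchange_big /=.
under eq_bigr => p _ do rewrite sum_orthogonality.
rewrite -big_distrr /=; congr (_ * _).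
rewrite -[RHS]natz -sum1_card natr_sum.
rewrite (eq_bigl (fun p => (p.1 \in A) && (p.2 \in A))); last first.
  by case=> x y; rewrite inE.
rewrite -(pair_big_dep _ (fun=> mem A) (fun x y => (x - y == 0)%R%:Z)) /=.
apply: eq_bigr => x xA; rewrite (bigD1 x) //= subrr eqxx big1 ?addr0 //.
by move=> y /andP[_ yx]; rewrite subr_eq0 eq_sym (negPf yx).
Qed.

(* Resampling the coordinate [h j] moves the linear combination injectively
   through the whole space. *)
Lemma sum_family_combination (I : finType) (h : I -> V) (c : I -> F) (j : I)
    B (g : 'rV[F]_d -> int) :
  injective h -> c j != 0 -> (forall z, 0 <= g z) ->
  (\sum_(y in family B) g (\sum_i c i *: y (h i))) * #|B (h j)|%:Z
    <= (\prod_v #|B v|)%N%:Z * \sum_z g z.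
Proof.
move=> h_inj cj g_ge0.
(* [B'] freezes the coordinate [h j] at 0. The map [split] trades that coordinate for the
   combination, from which it is recovered since c_j is nonzero. *)
pose B' v := if v == h j then [set 0] else B v.
pose split (y : {ffun V -> 'rV[F]_d}) :=
  ([ffun v => if v == h j then 0 else y v], \sum_i c i *: y (h i)).
have split_inj : {in family B &, injective split}.
  move=> y y' _ _ [/ffunP eq_off].
  have eqy v : v != h j -> y v = y' v.
    by move=> vj; have := eq_off v; rewrite !ffunE (negPf vj).
  rewrite (bigD1 j) // [RHS](bigD1 j) //=.
  rewrite [X in _ + X = _](eq_bigr (fun i => c i *: y' (h i))) => [|i ij].
    move=> /addIr /(scalerI cj) eqj; apply/ffunP => v.
    by have [->|/eqy] := eqVneq v (h j).
  by rewrite eqy // (inj_eq h_inj).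
have -> : \sum_(y in family B) g (\sum_i c i *: y (h i))
    = \sum_(p in split @: family B) g p.2 by rewrite big_imset.
have card_B : (#|family B'| * #|B (h j)| = \prod_v #|B v|)%N.
  rewrite card_family_prod (bigD1 (h j)) //= {1}/B' eqxx cards1 mul1n.
  rewrite [RHS](bigD1 (h j)) //= mulnC; congr (_ * _)%N.
  by apply: eq_bigr => v vj; rewrite /B' (negPf vj).
rewrite -card_B PoszM mulrAC ler_wpM2r //.
(* Since g is nonnegative, the image of [split] may be enlarged to the whole product. *)
apply: (@le_trans _ _ (\sum_(p | (p.1 \in family B') && predT p.2) g p.2)).
  rewrite [leRHS](bigID (fun p => p \in split @: family B)) /=.
  rewrite -[leLHS]addr0 lerD ?sumr_ge0 //.
  rewrite le_eqVlt; apply/orP; left; apply/eqP; apply: eq_bigl => p.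
  rewrite andbC; case: imsetP => //= -[y yB ->] /=; rewrite andbT.
  symmetry; apply/familyP => v; rewrite ffunE /B'.
  by case: eqP => _; [rewrite inE | exact: (familyP yB)].
rewrite -(pair_big (mem (family B')) predT (fun _ z => g z)) /=.
by rewrite sumr_const -mulr_natl natz.
Qed.

Lemma common_dotp_count A B N :
  (forall v, v \in N -> (q ^ (d + #|N|) <= #|B v| * #|A|)%N) ->
  (q ^ #|N| * #|[set p : {ffun V -> 'rV[F]_d} * ('rV[F]_d * 'rV[F]_d) |
       [&& p.1 \in family B, p.2 \in setX A A &
          [forall v in N, dotp (p.2.1 - p.2.2) (p.1 v) == 0%R]]]|
     <= 2 * (\prod_v #|B v| * #|A| ^ 2))%N.
Proof.
move=> large.
set G := [set p | _]; set P := (\prod_v _)%N; set t := #|N|.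
pose h (i : 'I_t) : V := enum_val i.
pose combo (s : 'rV[F]_t) (y : {ffun V -> 'rV[F]_d}) :=
  \sum_i s 0 i *: y (h i).
(* For fixed y and (a, b), orthogonality is applied in F^t to the vector [u] of the dot products (a
   - b).y_j, which vanishes exactly when all the conditions hold. *)
have countE : (q%:Z - 1) * q%:Z ^+ t * #|G|%:Z
    = \sum_(s : 'rV[F]_t) \sum_(y in family B) excess A (combo s y).
  rewrite exchange_big /=.
  rewrite (eq_bigr (fun y : {ffun V -> 'rV[F]_d} => \sum_(p in setX A A)
     ((q%:Z - 1) * q%:Z ^+ t *
       [forall v in N, dotp (p.1 - p.2) (y v) == 0%R]%:Z))); last first.
    move=> y _; rewrite exchange_big /=; apply: eq_bigr => p _.
    pose u : 'rV[F]_t := \row_i dotp (p.1 - p.2) (y (h i)).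
    rewrite (eq_bigr (fun s => q%:Z * (dotp u s == 0)%R%:Z - 1)); last first.
      move=> s _; congr (_ * Posz (nat_of_bool (_ == _)) - _).
      rewrite /combo dotp_sumr; apply: eq_bigr => i _.
      by rewrite dotpZr mxE mulrC.
    rewrite sum_orthogonality; congr (_ * Posz (nat_of_bool _)).
    apply/eqP/forall_inP => [u0 v vN|orth].
      have /rowP/(_ (enum_rank_in vN v)) := u0.
      by rewrite !mxE /h enum_rankK_in // => ->.
    by apply/rowP => i; rewrite !mxE; apply/eqP/orth/enum_valP.
  rewrite pair_big /= -big_distrr /=; congr (_ * _).
  rewrite -[LHS]natz -sum1_card natr_sum big_mkcond [RHS]big_mkcond /=.
  apply: eq_bigr => -[y p] _; rewrite !inE /=.
  have ifE (a b : bool) : (if a && b then 1 else 0) = if a then b%:Z else 0.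
    by case: a b => [] [].
  by rewrite andbA; exact: ifE.
have P2 : 0 <= (q%:Z - 1) * (P * #|A| ^ 2)%N%:Z.
  by rewrite mulr_ge0 // subr_ge0 ltW.
(* Each nonzero s contributes at most q^-t times the main term: the bound by [sum_excess] carries a
   factor q^d |A|, and [large] absorbs q^(d + t) into |B_j| |A|. *)
have sum_s s : s != 0 -> q%:Z ^+ t * \sum_(y in family B) excess A (combo s y)
    <= (q%:Z - 1) * (P * #|A| ^ 2)%N%:Z.
  move=> /rV0Pn[j sj].
  have := sum_family_combination B (@enum_val_inj _ (mem N)) sj (excess_ge0 A).
  rewrite sum_excess -/(combo s) -/P -/(h j); set S := \sum_(y in _) _ => leS.
  have S_ge0 : 0 <= S by apply: sumr_ge0 => y _; exact: excess_ge0.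
  have := large (h j) (enum_valP j); rewrite -lez_nat expnD !PoszM.
  rewrite -[X in X * _ <= _]natz -[X in _ * X <= _]natz !natrX !natz -/t => large_j.
  have := ler_wpM2r S_ge0 large_j.
  have qd_gt0 : 0 < q%:Z ^+ d by rewrite exprn_gt0 // (lt_trans _ q_gt1).
  move=> le1; rewrite -(ler_pM2l qd_gt0) [leLHS]mulrA; apply: (le_trans le1).
  have := ler_wpM2r (isT : 0 <= #|A|%:Z) leS; lra.
have sum0 : \sum_(y in family B) excess A (combo 0 y)
    = (q%:Z - 1) * (P * #|A| ^ 2)%N%:Z.
  rewrite (eq_bigr (fun=> excess A 0)) => [|y _]; last first.
    by rewrite /combo big1 // => i _; rewrite mxE scale0r.
  rewrite sumr_const card_family_prod -/P excess0 -mulr_natl natz PoszM.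
  by rewrite mulrCA.
have qt_gt0 : 0 < q%:Z ^+ t by rewrite exprn_gt0 // (lt_trans _ q_gt1).
have q1_gt0 : 0 < q%:Z - 1 by rewrite subr_gt0.
rewrite -lez_nat -(ler_pM2l (mulr_gt0 q1_gt0 qt_gt0)) (PoszM (q ^ t)%N).
rewrite -[(q ^ t)%N%:Z]natz natrX natz mulrCA countE (bigD1 0) //= sum0.
rewrite mulrDr mulr_sumr.
(* There are at most q^t nonzero s, so together they add at most one more main term; hence the
   factor 2. *)
have : \sum_(s : 'rV[F]_t | s != 0)
         q%:Z ^+ t * (\sum_(y in family B) excess A (combo s y))
    <= q%:Z ^+ t * ((q%:Z - 1) * (P * #|A| ^ 2)%N%:Z).
  apply: le_trans (ler_sum _ sum_s) _; rewrite sumr_const -mulr_natl.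
  rewrite ler_wpM2r //.
  rewrite -[X in _ <= X ^+ _]natz -natrX ler_nat -[t in leqRHS]mul1n.
  by rewrite -card_mx max_card.
rewrite [(2 * _)%N]mul2n -addnn PoszD; lra.
Qed.

End CommonDotProducts.

(** * Eliminating one vertex *)

Section VertexElimination.

Variables (F : finFieldType) (d : nat) (V : finType) (E : {set {set V}}).
Implicit Types (x : {ffun V -> 'rV[F]_d}) (U : {set V}) (e : {set V}).
Implicit Types (A : V -> {set 'rV[F]_d}) (S : {set {ffun V -> 'rV[F]_d}}).

(** An edge is unordered, so an ordering of its ends is picked; symmetry of the dot product makes
    the choice harmless. The default 0 occurs only when e is not of the form {u, v}. *)
Definition edge_dot x e : F :=
  if [pick p : V * V | e == [set p.1; p.2]] is Some p
  then dotp (x p.1) (x p.2) else 0.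

Lemma edge_dotE x u v : edge_dot x [set u; v] = dotp (x u) (x v).
Proof.
rewrite /edge_dot; case: pickP => [[a b] /= /eqP uv|/(_ (u, v))]; last first.
  by rewrite eqxx.
have [au bu] : a \in [set u; v] /\ b \in [set u; v] by rewrite uv set21 set22.
have [ua va] : u \in [set a; b] /\ v \in [set a; b] by rewrite -uv set21 set22.
case/set2P: au bu ua va => -> /set2P[] -> ua va //.
- by case/set2P: va => ->.
- exact: dotpC.
- by case/set2P: ua => ->.
Qed.

(** Padding by 0 keeps one type for all U while forgetting the points outside U. *)
Definition restrict U x : {ffun V -> 'rV[F]_d} :=
  [ffun v => if v \in U then x v else 0].

Lemma edge_dot_restrict U x e :
  e \subset U -> edge_dot (restrict U x) e = edge_dot x e.
Proof.
move=> eU; rewrite /edge_dot; case: pickP => [[a b] /= /eqP eab|//].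
by rewrite !ffunE !(subsetP eU) // eab ?set21 ?set22.
Qed.

Definition outer_edges U : {set edge E} :=
  [set e : edge E | ~~ (val e \subset U)].

(* Points at the vertices of [U], dot products on the edges not inside [U], 0 elsewhere. *)
Definition partial_config U x : {ffun V -> 'rV[F]_d} * {ffun edge E -> F} :=
  (restrict U x,
   [ffun e : edge E => if val e \subset U then 0 else edge_dot x (val e)]).

Definition inner_nbrs U v : {set V} := [set j in U | [set v; j] \in E].

(** The edges that become outer when v is removed are the {v, j} with j a neighbour of v in U, and j
    -> {v, j} is injective on these. *)
Lemma card_outer_edges U v : simple_graph E -> v \notin U ->
  #|outer_edges U| = (#|outer_edges (v |: U)| + #|inner_nbrs U v|)%N.
Proof.
move=> simpleE vU.
have sub : outer_edges (v |: U) \subset outer_edges U.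
  apply/subsetP => e; rewrite !inE; apply: contra => eU.
  exact: subset_trans eU (subsetUr _ _).
rewrite -(cardsID (outer_edges (v |: U)) (outer_edges U)) (setIidPr sub).
congr (_ + _)%N.
rewrite -(card_imset _ val_inj) -(card_in_imset (f := fun j => [set v; j])).
  apply: eq_card => e; apply/imsetP/imsetP => [[e' + ->]|[j]].
    rewrite !inE negbK => /andP[evU eU].
    have ve : v \in val e'.
      apply: contraR eU => ve; apply/subsetP => j je.
      have := subsetP evU j je; rewrite !inE => /orP[/eqP jv|//].
      by rewrite -jv je in ve.
    have /eqP/cards2P[a [b [ab e_ab]]] := simpleE _ (valP e').
    have [j jv ej] : exists2 j, j != v & val e' = [set v; j].
      move: ve; rewrite e_ab => /set2P[->|->]; first by exists b; rewrite // eq_sym.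
      by exists a; rewrite // setUC.
    exists j; last by [].
    rewrite inE -ej (valP e') andbT.
    have : j \in v |: U by apply: (subsetP evU); rewrite ej set22.
    by rewrite !inE (negPf jv).
  rewrite inE => /andP[jU vjE] ->; exists (Sub [set v; j] vjE); last by [].
  rewrite !inE negbK SubK; apply/andP; split.
    by apply/subsetP => i /set2P[] ->; rewrite !inE ?eqxx ?jU ?orbT.
  by apply: contra vU => /subsetP; apply; rewrite set21.
move=> i j; rewrite !inE => /andP[iU _] _ /setP/(_ i).
rewrite !inE eqxx orbT; case: (i =P v) => [iv|_ /esym/eqP //].
by rewrite -iv iU in vU.
Qed.

(** Cauchy-Schwarz for the map [psi], which replaces the point at v by its dot products with the
    neighbours in U; its collisions are bounded by [common_dotp_count]. *)
Lemma card_partial_config_step A S U v : v \notin U -> S \subset family A ->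
  (forall j, j \in inner_nbrs U v ->
     (#|F| ^ (d + #|inner_nbrs U v|) <= #|A j| * #|A v|)%N) ->
  (#|partial_config (v |: U) @: S| ^ 2 * #|F| ^ #|inner_nbrs U v|
     <= 2 * #|partial_config U @: S|
        * (#|F| ^ #|outer_edges (v |: U)| * #|A v| ^ 2 * \prod_(i in U) #|A i|))%N.
Proof.
move=> vU SA large.
set N := inner_nbrs U v; set T := partial_config (v |: U) @: S.
pose state := ({ffun V -> 'rV[F]_d} * {ffun edge E -> F})%type.
pose psi (p : state) : state :=
  (restrict U p.1, [ffun e : edge E => if val e \subset U then 0
     else if val e \subset v |: U then edge_dot p.1 (val e) else p.2 e]).
have psiT : psi @: T = partial_config U @: S.
  rewrite /T -imset_comp; apply: eq_imset => x; congr pair; apply/ffunP => i.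
    by rewrite !ffunE !inE; case: (i \in U); rewrite ?orbT.
  rewrite !ffunE; case: ifP => // _; case: ifP => [iU|->] //.
  by rewrite edge_dot_restrict.
have T1 (p : state) (i : V) : p \in T ->
    p.1 i \in (if i \in v |: U then A i else [set 0]).
  case/imsetP => x xS -> /=; rewrite ffunE; case: ifP => _; last by rewrite inE.
  by have /familyP := subsetP SA x xS; apply.
have T2 (p : state) (e : edge E) : p \in T -> val e \subset v |: U -> p.2 e = 0.
  by case/imsetP => x xS -> /= eU; rewrite ffunE eU.
(* The singletons off U match the padding by 0 and contribute factors 1 to the product. *)
pose B i := if i \in U then A i else [set 0].
have prodB : (\prod_i #|B i| = \prod_(i in U) #|A i|)%N.
  by rewrite [RHS]big_mkcond; apply: eq_bigr => i _; rewrite /B; case: ifP;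
    rewrite ?cards1.
have /common_dotp_count : forall j, j \in N -> (#|F| ^ (d + #|N|) <= #|B j| * #|A v|)%N.
  by move=> j jN; have := large j jN; move: jN; rewrite inE /B => /andP[-> _].
set G := [set p | _]; rewrite prodB => leG.
pose W : {set {ffun edge E -> F}} :=
  [set alpha in pffun_on 0 (mem (outer_edges (v |: U))) predT].
have cardW : #|W| = (#|F| ^ #|outer_edges (v |: U)|)%N.
  by rewrite cardsE card_pffun_on.
set D := [set p in setX T T | psi p.1 == psi p.2].
have leD : (#|D| <= #|W| * #|G|)%N.
  (* A colliding pair shares its points on U and its labels on the edges outside v |: U, so it is
     determined by these and its two points at v. *)
  pose rho (p : state * state) :=
    (p.1.2, (restrict U p.1.1, (p.1.1 v, p.2.1 v))).
  rewrite -cardsX -(card_in_imset (f := rho)).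
    apply: subset_leq_card; apply/subsetP => _ /imsetP[[p p'] + ->].
    rewrite [in X in X -> _]inE /= => /andP[/setXP[pT p'T] /eqP[eq1 eq2]].
    apply/setXP; split; rewrite inE /=.
      apply/pffun_onP; split; last by move=> ? _.
      by apply/supportP => e; rewrite inE negbK; exact: T2.
    apply/and3P; split; last first.
    (* The two states have the same x_j and the same label on {v, j}, whence (a - b).x_j = 0. *)
    - apply/forall_inP => j; rewrite inE => /andP[jU vjE].
      have := congr1 (fun f : {ffun edge E -> F} => f (Sub [set v; j] vjE)) eq2.
      have vjU : [set v; j] \subset U = false.
        by apply/negP => /subsetP/(_ v); rewrite set21 (negPf vU) => /(_ isT).
      have vjvU : [set v; j] \subset v |: U.
        by rewrite subUset !sub1set !inE eqxx jU orbT.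
      have := congr1 (fun f : {ffun V -> 'rV[F]_d} => f j) eq1.
      rewrite !ffunE SubK vjU vjvU jU !edge_dotE dotpBl subr_eq0.
      by move=> -> /eqP.
    - by apply/setXP; split; [have := T1 p v pT|have := T1 p' v p'T];
        rewrite setU11.
    apply/familyP => i; rewrite ffunE /B; have := T1 p i pT; rewrite !inE.
    by case: (i \in U); rewrite ?orbT ?inE.
  have glue (p r : state) : p \in T -> r \in T ->
      restrict U p.1 = restrict U r.1 -> p.1 v = r.1 v -> p.1 = r.1.
    move=> pT rT /ffunP eqU eqv; apply/ffunP => i.
    have := eqU i; rewrite !ffunE; have := (T1 p i pT, T1 r i rT); rewrite !inE.
    have [->|_] := eqVneq i v => //; case: (i \in U) => //= -[].
    by rewrite !inE => /eqP-> /eqP->.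
  have collide (p : state * state) : p \in D ->
      [/\ p.1 \in T, p.2 \in T & psi p.1 = psi p.2].
    by rewrite inE; case: p => p r /andP[/setXP[? ?] /eqP].
  move=> [p1 p2] [r1 r2] /collide[/= p1T p2T [pU pE]] /collide[/= r1T r2T [rU rE]].
  case=> eq2 eqU eqv1 eqv2.
  have eq1 : p1.1 = r1.1 by exact: glue.
  have eq1' : p2.1 = r2.1 by apply: glue; rewrite // -pU -rU.
  have eq2' : p2.2 = r2.2.
    apply/ffunP => e; case evU: (val e \subset v |: U); first by rewrite !T2.
    have eU : val e \subset U = false.
      by apply: contraFF evU => /subset_trans; apply; exact: subsetUr.
    have := congr1 (fun f : {ffun edge E -> F} => f e) pE.
    have := congr1 (fun f : {ffun edge E -> F} => f e) rE.
    by rewrite !ffunE evU eU eq2 => <- <-.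
  congr pair.
    by rewrite [p1]surjective_pairing eq1 eq2 -surjective_pairing.
  by rewrite [p2]surjective_pairing eq1' eq2' -surjective_pairing.
have := card_sqr_leq_collisions psi T; rewrite -/D psiT cardW in leD * => leT.
rewrite -/T; set t := (_ ^ #|N|)%N in leG *; set w := (_ ^ _)%N in leD *.
apply: leq_trans (_ : #|partial_config U @: S| * (w * #|G|) * t <= _)%N.
  by rewrite leq_mul2r (leq_trans leT) ?orbT // leq_mul2l leD orbT.
set X := #|_ @: S|; set b := (_ ^ 2)%N in leG *.
have -> : (X * (w * #|G|) * t = X * w * (t * #|G|))%N by ring.
set c := (\prod_(i in U) _)%N in leG *.
have -> : (2 * X * (w * b * c) = X * w * (2 * (c * b)))%N by ring.
by rewrite leq_mul2l leG orbT.
Qed.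

(** * Iterating the elimination *)

Definition density_loss (R : realType) (delta : R) : R := delta ^+ 2 / 2.

Lemma density_loss_gt0 (R : realType) (delta : R) n :
  0 < delta -> 0 < iter n (@density_loss R) delta.
Proof.
move=> delta_gt0; elim: n => //= n IHn.
by rewrite divr_gt0 ?ltr0n // exprn_gt0.
Qed.

(** Induction on the number of removed vertices. Each removal squares the density, by
    Cauchy-Schwarz, and halves it, by the factor 2 in the collision count. *)
Lemma partial_config_density (R : realType) A S (delta : R) :
  simple_graph E -> (forall v, 0 < #|A v|)%N -> S \subset family A ->
  (forall i j, [set i; j] \in E ->
     (#|F| ^ (d + #|V| - 1) <= #|A i| * #|A j|)%N) ->
  0 < delta -> delta * (\prod_v #|A v|)%:R <= #|S|%:R ->
  forall U, iter #|~: U| (@density_loss R) delta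
      * (#|F| ^ #|outer_edges U| * \prod_(v in U) #|A v|)%:R
    <= #|partial_config U @: S|%:R.
Proof.
move=> simpleE A_gt0 SA large delta_gt0 dense U.
have [n] := ubnP #|~: U|; elim: n U => // n IHn U; rewrite ltnS => leUn.
have [UT|[v]] := set_0Vmem (~: U).
  (* With no vertex removed there are no outer edges and [partial_config] is injective, so the bound
     is the density of S. *)
  have {}UT : U = setT by rewrite -[U]setCK UT setC0.
  rewrite {}UT setCT cards0 /=.
  have -> : outer_edges setT = set0.
    by apply/setP => e; rewrite !inE subsetT.
  rewrite cards0 expn0 mul1n card_imset; last first.
    move=> x y [/ffunP xy _]; apply/ffunP => v; have := xy v.
    by rewrite !ffunE in_setT.
  by under eq_bigl do rewrite in_setT.
rewrite inE => vU.
have cardC : #|~: U| = #|~: (v |: U)|.+1.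
  by rewrite (cardsD1 v) inE vU setCU setIC -setDE add1n; congr _.+1.
rewrite cardC in leUn *; have := IHn _ leUn; rewrite iterS.
set c := iter _ _ _; have c_gt0 : 0 < c by exact: density_loss_gt0.
set N := inner_nbrs U v.
(* v is not in U, so it has at most k - 1 neighbours there; this is what the exponent d + k - 1 pays
   for. *)
have cardN : (#|N| <= #|V| - 1)%N.
  rewrite subn1 -(cardsC1 v); apply: subset_leq_card; apply/subsetP => j.
  by rewrite !inE => /andP[jU _]; apply: contraNneq vU => <-.
have V_gt0 : (0 < #|V|)%N by apply/card_gt0P; exists v.
have large_N j : j \in N -> (#|F| ^ (d + #|N|) <= #|A j| * #|A v|)%N.
  rewrite inE => /andP[_ /large]; rewrite mulnC; apply: leq_trans.
  rewrite leq_pexp2l ?(ltnW (card_finNzRing_gt1 F)) //; lia.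
have := card_partial_config_step vU SA large_N.
rewrite -/N (card_outer_edges simpleE vU) -/N.
rewrite (big_setU1 _ vU) /=.
rewrite expnD.
set t := (_ ^ #|N|)%N; set w := (_ ^ #|outer_edges _|)%N; set P := (\prod_(i in U) _)%N.
set X := #|_|; set Y := #|_|; rewrite -(ler_nat R) => step dense_vU.
have w_gt0 : (0 < w)%N by rewrite expn_gt0 (ltnW (card_finNzRing_gt1 F)).
have P_gt0 : (0 < P)%N by apply: prodn_cond_gt0 => i _.
have := A_gt0 v; move: #|A v| step dense_vU => a step dense_vU a_gt0.
clearbody c w t P X Y; rewrite /density_loss.
have sqr_dense : (c * (w * (a * P))%:R) ^+ 2 * t%:R <= X%:R ^+ 2 * t%:R.
  by rewrite ler_wpM2r // lerXn2r // nnegrE ?mulr_ge0 // ltW.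
have waP_gt0 : 0 < 2 * (w * (a * a) * P)%:R :> R.
  by rewrite mulr_gt0 // ltr0n !muln_gt0 w_gt0 P_gt0 a_gt0.
rewrite -(ler_pM2l waP_gt0).
rewrite -natrX -natrM in sqr_dense; have := le_trans sqr_dense step.
rewrite -mulnn !natrM; clear.
move: w%:R a%:R P%:R t%:R Y%:R => {}w {}a {}P {}t {}Y.
have -> : 2 * (w * (a * a) * P) * (c ^+ 2 / 2 * (w * t * P))
    = (c * (w * (a * P))) ^+ 2 * t by field.
have -> : 2 * (w * (a * a) * P) * Y = 2 * Y * (w * (a * a) * P) by ring.
by [].
Qed.

End VertexElimination.

(** * From configurations to [Pi_G] *)

Lemma Pi_GE (F : finFieldType) (d k : nat) (E : {set {set 'I_k}})
    (S : {set {ffun 'I_k -> 'rV[F]_d}}) : simple_graph E ->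
  #|Pi_G E S| = #|partial_config E set0 @: S|.
Proof.
move=> simpleE.
have edge0 (e : edge E) : (val e \subset set0) = false.
  by apply/negbTE; rewrite subset0 -cards_eq0 simpleE ?(valP e).
(* Over the empty set the point component is constantly 0, so only the edge labels matter. *)
rewrite -[RHS](card_in_imset (f := snd)); last first.
  move=> _ _ /imsetP[x _ ->] /imsetP[y _ ->] /= eq2; congr pair => //.
  by apply/ffunP => i; rewrite !ffunE inE.
rewrite -imset_comp; apply: eq_card => alpha; rewrite inE.
apply/exists_inP/imsetP => [[x xS dots]|[x xS ->]]; exists x => //.
  apply/ffunP => e; rewrite ffunE edge0.
  have /eqP/cards2P[i [j [_ e_ij]]] := simpleE _ (valP e).
  have /forallP/(_ e)/forallP/(_ i)/forallP/(_ j) := dots.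
  by rewrite e_ij eqxx edge_dotE => /eqP.
apply/forallP => e; apply/forallP => i; apply/forallP => j.
by apply/implyP => /eqP e_ij; rewrite ffunE edge0 e_ij edge_dotE.
Qed.

Lemma connected_graph_nbr (V : finType) (E : {set {set V}}) (v : V) :
  connected_graph E -> (1 < #|V|)%N -> exists w, [set v; w] \in E.
Proof.
move=> conn; rewrite (cardD1 v) inE add1n ltnS => /card_gt0P[u].
rewrite !inE andbT => uv; have /connectP[[|w p] /=] := conn v u.
  by move=> _ vu; rewrite vu eqxx in uv.
by case/andP=> vw _ _; exists w.
Qed.

Lemma Pi_G_density (R : realType) (k d : nat) (delta : R) (F : finFieldType)
    (E : {set {set 'I_k}}) (A : 'I_k -> {set 'rV[F]_d})
    (S : {set {ffun 'I_k -> 'rV[F]_d}}) :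
  (2 <= k)%N -> simple_graph E -> connected_graph E ->
  (forall i j : 'I_k, [set i; j] \in E ->
     (#|F| ^ (d + k - 1) <= #|A i| * #|A j|)%N) ->
  S \subset cart A -> 0 < delta ->
  delta * (\prod_(i < k) #|A i|)%:R <= #|S|%:R ->
  iter k (@density_loss R) delta * (#|F| ^ #|E|)%:R <= #|Pi_G E S|%:R.
Proof.
move=> k_ge2 simpleE conn large SA delta_gt0 dense.
(* By connectedness v lies on an edge, where the size condition excludes an empty A_v. *)
have A_gt0 v : (0 < #|A v|)%N.
  have [|w vw] := connected_graph_nbr v conn; first by rewrite card_ord.
  have := large v w vw; apply: contraTT; rewrite -eqn0Ngt => /eqP->.
  by rewrite mul0n -ltnNge expn_gt0 (ltnW (card_finNzRing_gt1 F)).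
have SA' : S \subset family A.
  by apply: subset_trans SA _; apply/subsetP => x; rewrite inE.
have large' i j : [set i; j] \in E ->
    (#|F| ^ (d + #|'I_k| - 1) <= #|A i| * #|A j|)%N.
  by rewrite card_ord; exact: large.
have := partial_config_density simpleE A_gt0 SA' large' delta_gt0 dense set0.
rewrite setC0 cardsT card_ord big_set0 muln1 Pi_GE //.
have -> : outer_edges E set0 = setT.
  apply/setP => e; rewrite !inE subset0 -cards_eq0 simpleE //.
  exact: (valP e).
by rewrite cardsT card_sig.
Qed.

Theorem theorem3 (R : realType) (k : nat) (hk : (2 <= k)%N) :
  exists C : R, 0 < C /\
  forall d : nat, (k <= d + 1)%N ->
    (forall K : R, 0 < K ->
     exists K' : R, 0 < K' /\
     forall (F : finFieldType) (E : {set {set 'I_k}})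
            (A : 'I_k -> {set 'rV[F]_d}),
       simple_graph E -> connected_graph E ->
       (forall i j : 'I_k, [set i; j] \in E ->
          C * (#|F| ^ (d + k - 1))%:R <= (#|A i| * #|A j|)%:R) ->
       forall S : {set {ffun 'I_k -> 'rV[F]_d}},
         S \subset cart A ->
         comparable_upto K #|S| (\prod_(i < k) #|A i|) ->
         lesssim_upto K' (#|F| ^ #|E|) #|Pi_G E S|)
    /\
    (exists K' : R, 0 < K' /\
     forall (F : finFieldType) (E : {set {set 'I_k}})
            (A : 'I_k -> {set 'rV[F]_d}),
       simple_graph E -> connected_graph E ->
       (forall i j : 'I_k, [set i; j] \in E ->
          C * (#|F| ^ (d + k - 1))%:R <= (#|A i| * #|A j|)%:R) ->
       lesssim_upto K' (#|F| ^ #|E|) #|Pi_G E (cart A)|).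
Proof.
exists 1; split=> // d _.
have main (K : R) : 0 < K -> exists K' : R, 0 < K' /\
    forall (F : finFieldType) (E : {set {set 'I_k}}) (A : 'I_k -> {set 'rV[F]_d}),
      simple_graph E -> connected_graph E ->
      (forall i j : 'I_k, [set i; j] \in E ->
         1 * (#|F| ^ (d + k - 1))%:R <= (#|A i| * #|A j|)%:R :> R) ->
      forall S : {set {ffun 'I_k -> 'rV[F]_d}}, S \subset cart A ->
        lesssim_upto K (\prod_(i < k) #|A i|) #|S| ->
        lesssim_upto K' (#|F| ^ #|E|) #|Pi_G E S|.
  (* The initial density is 1/K; after k losses it is c, and K' = 1/c. *)
  move=> K_gt0; pose c := iter k (@density_loss R) K^-1.
  have c_gt0 : 0 < c by rewrite density_loss_gt0 ?invr_gt0.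
  exists c^-1; split=> [|F E A simpleE conn large S SA dense].
    by rewrite invr_gt0.
  rewrite /lesssim_upto ler_pdivlMl //.
  apply: Pi_G_density SA _ _; rewrite ?invr_gt0 //.
    by move=> i j ij; have := large i j ij; rewrite mul1r ler_nat.
  by rewrite ler_pdivrMl.
split=> [K /main[K' [K'_gt0 bound]]|].
  exists K'; split=> // F E A simpleE conn large S SA [_ dense].
  exact: (bound F E A).
(* The full product has density 1. *)
have [K' [K'_gt0 bound]] := main 1 ltr01.
exists K'; split=> // F E A simpleE conn large.
apply: (bound F E A) => //.
by rewrite /lesssim_upto mul1r /cart cardsE card_family_prod.
Qed.
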